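(* Let $r\in\mathbb N$, $k_1,\dots,k_r\in\mathbb N$, and $\sigma_i\in P(k_i)$ for $i=1,\dots,r$. Let $k=\sum_{i=1}^r k_i$ and let $\gamma\in S_k$ be the trace permutation associated to $k_1,\dots,k_r$. Then for every $n$ such that the matrix $(n^{|p\vee q|})_{p,q\in D_k}$ is invertible, the classical cumulants with respect to the Haar measure on $H_n$ satisfy $$c_r[Z(\sigma_1),\dots,Z(\sigma_r)]=\#\{q\in D_k : q=\gamma(q),\ q\vee\gamma=1_k,\ q \text{ restricted to the } i\text{-th cycle of }\gamma \text{ is } \sigma_i\ (i=1,\dots,r)\}.$$
   Context: $H_n=\mathbb Z_2\wr S_n\subseteq O_n$ is the group of signed permutation matrices, with coordinate functions $u_{ij}$. $P(l)$ is the set of partitions of $\{1,\dots,l\}$. For a multi-index $\mathbf i=(i_1,\dots,i_l)$, $\ker\mathbf i\in P(l)$ is the partition in which $s,t$ are in the same block iff $i_s=i_t$. For $\sigma\in P(l)$, $Z(\sigma):=\sum_{\mathbf i\in\{1,\dots,n\}^l:\ \ker\mathbf i=\sigma}u_{i_1i_2}u_{i_2i_3}\cdots u_{i_li_1}$. $D_k$ is the set of partitions of $\{1,\dots,k\}$ all of whose blocks have even size. The trace permutation $\gamma\in S_k$ has cycles $(1,\dots,k_1)$, $(k_1+1,\dots,k_1+k_2)$, $\dots$, $(k-k_r+1,\dots,k)$; $\gamma$ is also viewed as the partition into these cycles; $\gamma(q)$ is the partition with blocks $\gamma(B)$, $B\in q$; $1_k$ is the one-block partition; $|p|$ the number of blocks,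 $\vee$ the join. ''$q$ restricted to the $i$-th cycle is $\sigma_i$'' means that the restriction of $q$ to $\{k_1+\dots+k_{i-1}+1,\dots,k_1+\dots+k_i\}$, relabeled by subtracting $k_1+\dots+k_{i-1}$, equals $\sigma_i$. Classical cumulants $c_r$ are defined by the moment-cumulant formula over all partitions. *)

(* Defs.v *)
From HB Require Import structures.
From mathcomp Require Import all_boot all_order fingroup perm all_algebra.
Unset Strict Implicit. Unset Printing Implicit Defensive.
Import Order.TTheory GRing.Theory Num.Theory.
Local Open Scope ring_scope.

(* Parameters of a signed permutation matrix: a permutation s of {1..n}
   and a sign vector eps.  The map spmx below is a bijection onto the set
   of n x n signed permutation matrices H_n = Z_2 wr S_n. *)
Definition sp_index (n : nat) := ('S_n * {ffun 'I_n -> bool})%type.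

Definition spmx {R : numFieldType} {n : nat} (g : sp_index n) : 'M[R]_n :=
  \matrix_(i, j) (if g.1 i == j then (-1) ^+ g.2 i else 0).

Definition u_coord {R : numFieldType} {n : nat} (i j : 'I_n) (A : 'M[R]_n) : R :=
  A i j.

Definition haar_Hn {R : numFieldType} (n : nat) (f : 'M[R]_n -> R) : R :=
  (#|{: sp_index n}|%:R)^-1 * \sum_(g : sp_index n) f (spmx g).

Definition ker_part {l n : nat} (f : 'I_l -> 'I_n) : {set {set 'I_l}} :=
  [set [set t | f t == f s] | s : 'I_l].

Definition Zfun {R : numFieldType} {n l : nat} (sigma : {set {set 'I_l}})
    (A : 'M[R]_n) : R :=
  \sum_(f : {ffun 'I_l -> 'I_n} | ker_part f == sigma)
     \prod_(s : 'I_l) u_coord (f s) (f (ordS s)) A.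

Definition Dk (K : nat) : {set {set {set 'I_K}}} :=
  [set q : {set {set 'I_K}} |
     partition q [set: 'I_K] && [forall B in q, ~~ odd #|B|]].

Definition pjoin {T : finType} (p q : {set {set T}}) : {set {set T}} :=
  let e := [rel x y | (y \in pblock p x) || (y \in pblock q x)] in
  [set [set y | connect e x y] | x : T].

Definition tot {r : nat} (ks : 'I_r -> nat) : nat := (\sum_(i < r) ks i)%N.
Definition off {r : nat} (ks : 'I_r -> nat) (i : 'I_r) : nat :=
  (\sum_(j < r | (j < i)%N) ks j)%N.

Definition cyc_block {r : nat} (ks : 'I_r -> nat) (i : 'I_r) : {set 'I_(tot ks)} :=
  [set x : 'I_(tot ks) | (off ks i <= x)%N && (x < off ks i + ks i)%N].

Definition gamma_part {r : nat} (ks : 'I_r -> nat) : {set {set 'I_(tot ks)}} :=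
  [set cyc_block ks i | i : 'I_r].

Definition gamma_fun {r : nat} (ks : 'I_r -> nat) (x : 'I_(tot ks)) : 'I_(tot ks) :=
  match [pick i | x \in cyc_block ks i] with
  | Some i => insubd x (if x.+1 == (off ks i + ks i)%N then off ks i else x.+1)
  | None => x
  end.

Definition gamma_act {r : nat} (ks : 'I_r -> nat) (q : {set {set 'I_(tot ks)}})
  : {set {set 'I_(tot ks)}} :=
  [set [set gamma_fun ks x | x in B] | B : {set 'I_(tot ks)} in q].

Definition restr_cycle {r : nat} (ks : 'I_r -> nat) (q : {set {set 'I_(tot ks)}})
    (i : 'I_r) : {set {set 'I_(ks i)}} :=
  [set [set t : 'I_(ks i) | [exists x in B, val x == (off ks i + t)%N]] | B : {set 'I_(tot ks)} in q]
    :\ set0.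

Definition gramD (R : numFieldType) (n K : nat) : 'M[R]_(#|Dk K|) :=
  \matrix_(a, b) ((n%:R : R) ^+ #|pjoin (enum_val a) (enum_val b)|).

(* c is the family of classical (joint) cumulants of the family of
   expectations E (E S = E[prod_{i in S} X_i]): moment-cumulant formula
   over all set partitions of every subset S. *)
Definition cumulant_family {R : numFieldType} {r : nat}
    (E : {set 'I_r} -> R) (c : {set 'I_r} -> R) : Prop :=
  forall S : {set 'I_r},
    E S = \sum_(P : {set {set 'I_r}} | partition P S) \prod_(B in P) c B.

(* Main.v *)
Require Import Defs.
From HB Require Import structures.
From mathcomp Require Import all_boot all_order fingroup perm all_algebra.
Set Implicit Arguments. Unset Strict Implicit. Unset Printing Implicit Defensive.
Import Order.TTheory GRing.Theory Num.Theory.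
Local Open Scope ring_scope.

(** Averaging [prod_x A_(F x, gamma F x)] over the signs forces every block of
    [q = ker F] to have even size; averaging over permutations forces [q] to be
    [gamma]-invariant, and since [S_n] acts transitively on the functions with
    kernel [q], the total contribution of such a [q] is 1 as soon as some [F]
    has kernel [q].  So the joint moment over a set [S] of cycles counts the
    admissible partitions of the union of these cycles.  Such a partition is
    uniquely glued from connected ones along the components of [q \/ gamma], so
    the connected counts satisfy the moment-cumulant formula, which determines
    the cumulants.  Invertibility of the Gram matrix makes every partition in
    [D_k] a kernel.  When [k] is odd, [D_k] is empty and the Gram hypothesis
    void, but then the symmetry [A |-> -A] kills the cumulant. *)

(** * Set partitions *)

Lemma block_eq (T : finType) (q : {set {set T}}) (D : {set T}) B C x :
  partition q D -> B \in q -> C \in q -> x \in B -> x \in C -> B = C.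
Proof.
move=> /partition_trivIset tq Bq Cq xB xC.
by rewrite -(def_pblock tq Bq xB) (def_pblock tq Cq xC).
Qed.

Lemma partition_block (T : finType) (q : {set {set T}}) (D : {set T}) x :
  partition q D -> x \in D -> exists2 B, B \in q & x \in B.
Proof. by move=> pq; rewrite -(cover_partition pq) => /bigcupP[B]; exists B. Qed.

Lemma partitionI (T : finType) (q : {set {set T}}) (D : {set T}) :
  set0 \notin q -> (forall B, B \in q -> B \subset D) ->
  (forall x, x \in D -> exists2 B, B \in q & x \in B) ->
  (forall B C x, B \in q -> C \in q -> x \in B -> x \in C -> B = C) ->
  partition q D.
Proof.
move=> q0 qD Dq qI; apply/and3P; split=> //.
  rewrite eqEsubset; apply/andP; split; first exact/bigcupsP.
  by apply/subsetP=> x /Dq[B Bq xB]; apply/bigcupP; exists B.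
apply/trivIsetP=> B C Bq Cq; apply: contraR => /pred0Pn[x /andP[xB xC]].
exact/eqP/(qI B C x).
Qed.

(** Since [p] already covers [D], every block of [q] meets a block of [p], which is itself a block
    of [q]. *)
Lemma partition_sub_eq (T : finType) (p q : {set {set T}}) (D : {set T}) :
  partition p D -> partition q D -> p \subset q -> p = q.
Proof.
move=> pp pq pSq; apply/eqP; rewrite eqEsubset pSq; apply/subsetP=> B Bq.
have /set0Pn[x xB] := partition_neq0 pq Bq.
have [C Cp xC] := partition_block pp (subsetP (partitionS pq Bq) x xB).
by rewrite (block_eq pq Bq (subsetP pSq C Cp) xB xC).
Qed.

(** * Decomposition into connected components *)

Section Components.
(** In the application [X] is the set of points, [I] the set of cycles, [kap] the cycle of a point
    and [loc i q] the requirement that cycle [i] puts on [q]. *)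
Variables (I X : finType) (kap : X -> I) (loc : I -> {set {set X}} -> bool).

Definition fib (S : {set I}) : {set X} := [set x | kap x \in S].

(** Generates the join of [q] with the partition into fibres of [kap], seen on the index set [I]. *)
Definition link (q : {set {set X}}) : rel I :=
  [rel i j | [exists C in q, [exists x in C,
     (kap x == i) && [exists y in C, kap y == j]]]].

Definition saturated (q : {set {set X}}) (S : {set I}) :=
  [forall C in q, (C \subset fib S) || [disjoint C & fib S]].

Definition structs S : {set {set {set X}}} :=
  [set q | partition q (fib S) & [forall i in S, loc i q]].

Definition connected_structs S : {set {set {set X}}} :=
  [set q in structs S | [forall i in S, forall j in S, connect (link q) i j]].

(** Locality: the requirement at [i] sees only the blocks inside a saturated union of fibres
    containing that of [i], so it passes between a structure and its components. *)
Hypothesis loc_restr : forall i (S : {set I}) q, i \in S -> saturated q S ->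
  loc i (q ::&: fib S) = loc i q.

Implicit Types (i j : I) (S T B : {set I}) (q : {set {set X}}).

Lemma linkP q i j :
  reflect (exists C x y, [/\ C \in q, x \in C, y \in C, kap x = i & kap y = j])
          (link q i j).
Proof.
apply: (iffP existsP) => [[C /andP[Cq /existsP[x /and3P[xC /eqP kx /existsP[y]]]]]|].
  by case/andP=> yC /eqP ky; exists C, x, y.
case=> C [x [y [Cq xC yC kx ky]]]; exists C; rewrite Cq /=; apply/existsP; exists x.
by rewrite xC kx eqxx; apply/existsP; exists y; rewrite yC ky eqxx.
Qed.

Lemma link_sym q : symmetric (link q).
Proof.
move=> i j; apply/linkP/linkP=> -[C [x [y [Cq xC yC kx ky]]]];
  by exists C, y, x; split.
Qed.

Lemma saturatedP q S :
  reflect (forall C x y, C \in q -> x \in C -> y \in C -> kap x \in S -> kap y \in S)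
          (saturated q S).
Proof.
apply: (iffP 'forall_implyP) => [sq C x y Cq xC yC xS|sq C Cq].
  case/orP: (sq C Cq) => [/subsetP/(_ y yC)|]; first by rewrite inE.
  by move/pred0P/(_ x); rewrite /= xC inE xS.
have [|/pred0Pn[x /andP[/= xC]]] := boolP [disjoint C & fib S]; first by rewrite orbT.
rewrite inE => xS; rewrite orbF; apply/subsetP=> y yC; rewrite inE.
exact: (sq C x y).
Qed.

Lemma saturated_link q S i j : saturated q S -> link q i j -> (i \in S) = (j \in S).
Proof.
move=> /saturatedP sq /linkP[C [x [y [Cq xC yC <- <-]]]].
by apply/idP/idP; [apply: (sq C x y) | apply: (sq C y x)].
Qed.

(** A path started in [S] cannot leave [S], and the blocks that witness its links lie over [S],
    hence survive the restriction. *)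
Lemma saturated_connect q S i j :
  saturated q S -> connect (link q) i j -> i \in S ->
  j \in S /\ connect (link (q ::&: fib S)) i j.
Proof.
move=> sq /connectP[p]; elim: p i => [|k p IHp] i /=; first by move=> _ -> iS.
case/andP=> lik pp jl iS.
have kS : k \in S by rewrite -(saturated_link sq lik).
have [jS ckj] := IHp k pp jl kS; split=> //; apply: connect_trans ckj.
apply: connect1; move: iS lik => /[swap] /linkP[C [x [y [Cq xC yC <- <-]]]] xS.
apply/linkP; exists C, x, y; split=> //; rewrite !inE Cq /=.
apply/subsetP=> z zC; rewrite inE; by move/saturatedP: sq => /(_ C x z); apply.
Qed.

Lemma partition_restr q S T :
  T \subset S -> saturated q T -> partition q (fib S) ->
  partition (q ::&: fib T) (fib T).
Proof.
move=> TS sq pq; apply: partitionI => [|B|x|B C x].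
- by rewrite inE (partition0 pq).
- by rewrite !inE => /andP[].
- rewrite inE => xT.
  have xS : x \in fib S by rewrite inE (subsetP TS).
  have [B Bq xB] := partition_block pq xS; exists B => //.
  rewrite !inE Bq; apply/subsetP=> y yB; rewrite inE.
  by move/saturatedP: sq => /(_ B x y); apply.
- by rewrite !inE => /andP[Bq _] /andP[Cq _]; apply: block_eq pq Bq Cq.
Qed.

Definition components S q := equivalence_partition (connect (link q)) S.

Lemma connect_link_equiv q (S : {set I}) :
  {in S & &, equivalence_rel (connect (link q))}.
Proof.
move=> i j k _ _ _; split=> [|cij]; first exact: connect0.
exact: (same_connect (sym_connect_sym (@link_sym q)) cij k).
Qed.

Lemma components_partition q S : partition (components S q) S.
Proof. exact/equivalence_partitionP/connect_link_equiv. Qed.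

(** Two points of one block have linked indices, so no block straddles two components. *)
Lemma saturated_component q S B :
  partition q (fib S) -> B \in components S q -> saturated q B.
Proof.
move=> pq BP; apply/saturatedP=> C x y Cq xC yC.
case/imsetP: BP => i iS ->; rewrite !inE => /andP[_ cix].
have yS : kap y \in S.
  by have := subsetP (partitionS pq Cq) y yC; rewrite inE.
by rewrite yS (connect_trans cix) // connect1 //; apply/linkP; exists C, x, y.
Qed.

Lemma component_struct q S B :
  q \in structs S -> B \in components S q -> q ::&: fib B \in connected_structs B.
Proof.
rewrite inE => /andP[pq /forall_inP lq] BP.
have sq := saturated_component pq BP.
have BS := partitionS (components_partition q S) BP.
rewrite !inE (partition_restr BS) //=; apply/andP; split.
  by apply/forall_inP=> i iB; rewrite loc_restr // lq // (subsetP BS).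
apply/forall_inP=> i iB; apply/forall_inP=> j jB.
suff cij : connect (link q) i j by have [] := saturated_connect sq cij iB.
case/imsetP: BP iB jB => k kS ->; rewrite !inE => /andP[iS cki] /andP[jS ckj].
by rewrite (connect_trans _ ckj) // (sym_connect_sym (@link_sym q)).
Qed.

Section Gluing.
Variables (S : {set I}) (P : {set {set I}}) (f : {set I} -> {set {set X}}).
Hypothesis partP : partition P S.
Hypothesis fP : forall B, B \in P -> f B \in connected_structs B.
(** The inverse of cutting along components: the connected pieces chosen over the parts of [P] are
    put side by side. *)
Let q := \bigcup_(B in P) f B.

Let fib_block B C : B \in P -> C \in f B -> C \subset fib B.
Proof.
move=> /fP; rewrite !inE => /andP[/andP[pf _] _]; exact: partitionS.
Qed.

Let glue_block B C x : B \in P -> C \in q -> x \in C -> kap x \in B -> C \in f B.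
Proof.
move=> BP /bigcupP[B' B'P CB'] xC xB.
have := subsetP (fib_block B'P CB') x xC; rewrite inE => xB'.
by rewrite (block_eq partP BP B'P xB xB').
Qed.

Lemma glue_saturated B : B \in P -> saturated q B.
Proof.
move=> BP; apply/saturatedP=> C x y Cq xC yC xB.
have Cf := glue_block BP Cq xC xB.
by have := subsetP (fib_block BP Cf) y yC; rewrite inE.
Qed.

Lemma glue_restr B : B \in P -> q ::&: fib B = f B.
Proof.
move=> BP; apply/setP=> C; rewrite !inE; apply/andP/idP=> [[Cq CB]|CB]; last first.
  by split; [apply/bigcupP; exists B | apply: fib_block].
have /set0Pn[x xC] : C != set0.
  apply: contraTneq Cq => ->; apply/negP=> /bigcupP[B' /fP].
  by rewrite !inE => /andP[/andP[pf _] _]; rewrite (partition0 pf).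
by apply: (glue_block BP Cq xC); have := subsetP CB x xC; rewrite inE.
Qed.

Lemma glue_partition : partition q (fib S).
Proof.
have fpart B : B \in P -> partition (f B) (fib B).
  by move=> /fP; rewrite !inE => /andP[/andP[]].
apply: partitionI => [|C /bigcupP[B BP CB]|x|C D x Cq Dq xC xD].
- by apply/negP=> /bigcupP[B /fpart pf]; rewrite (partition0 pf).
- apply: subset_trans (fib_block BP CB) _; apply/subsetP=> x; rewrite !inE.
  exact/subsetP/(partitionS partP).
- rewrite inE => /(partition_block partP)[B BP xB].
  have xfB : x \in fib B by rewrite inE.
  have [C CB xC] := partition_block (fpart B BP) xfB.
  by exists C => //; apply/bigcupP; exists B.
- have [B BP CB] := bigcupP Cq.
  have xB : kap x \in B by have := subsetP (fib_block BP CB) x xC; rewrite inE.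
  exact: (block_eq (fpart B BP) CB (glue_block BP Dq xD xB) xC xD).
Qed.

Lemma glue_struct : q \in structs S.
Proof.
rewrite inE glue_partition; apply/forall_inP=> i /(partition_block partP)[B BP iB].
rewrite -(loc_restr iB (glue_saturated BP)) glue_restr //.
by have := fP BP; rewrite !inE => /andP[/andP[_ /forall_inP/(_ i iB)]].
Qed.

(** Connectedness of [f B] puts [B] inside one component, and saturation of [B] keeps that component
    from growing. *)
Lemma glue_components : components S q = P.
Proof.
apply/esym/(partition_sub_eq partP (components_partition q S))/subsetP=> B BP.
have /set0Pn[i iB] := partition_neq0 partP BP.
have iS := subsetP (partitionS partP BP) i iB.
apply/imsetP; exists i => //; apply/setP=> j; rewrite inE.
apply/idP/andP=> [jB|[jS cij]]; last first.
  by have [] := saturated_connect (glue_saturated BP) cij iB.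
split; first exact: (subsetP (partitionS partP BP)).
have := fP BP; rewrite inE => /andP[_ /forall_inP/(_ i iB) /forall_inP/(_ j jB)].
apply: connect_sub => k l /linkP[C [x [y [Cf xC yC kx ky]]]].
apply: connect1; apply/linkP; exists C, x, y; split=> //.
by apply/bigcupP; exists B.
Qed.

End Gluing.

(** Cutting along components and gluing are mutually inverse, so a structure amounts to a partition
    [P] of [S] with a connected structure on every part. *)
Lemma card_structs S :
  #|structs S| = (\sum_(P | partition P S) \prod_(B in P) #|connected_structs B|)%N.
Proof.
rewrite -sum1_card (partition_big (components S) (fun P => partition P S)) /=; last first.
  by move=> q _; apply: components_partition.
apply: eq_bigr => P partP; apply/esym.
under eq_bigr do rewrite -sum1_card.
(* The product of cardinals becomes a sum over choice functions [f]; they take the default value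
   [set0] outside [P], which [h'] must reproduce. *)
rewrite (big_distr_big_dep set0) /=.
under eq_bigr => f _ do rewrite big1 //.
pose h (f : {ffun {set I} -> {set {set X}}}) := \bigcup_(B in P) f B.
pose h' q := [ffun B => if B \in P then q ::&: fib B else set0] : {ffun {set I} -> {set {set X}}}.
apply/esym; rewrite (reindex_onto h h') => [|q /andP[qS /eqP cq]]; last first.
  rewrite /h; apply/setP=> C; apply/bigcupP/idP=> [[B BP]|Cq].
    by rewrite ffunE BP !inE => /andP[].
  have := qS; rewrite inE => /andP[pq _].
  have /set0Pn[x xC] := partition_neq0 pq Cq.
  have := subsetP (partitionS pq Cq) x xC; rewrite inE => xS.
  have [B BP xB] := partition_block partP xS.
  exists B => //; rewrite ffunE BP !inE Cq /=; apply/subsetP=> y yC; rewrite inE.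
  have Bcq : B \in components S q by rewrite cq.
  by have /saturatedP/(_ C x y) := saturated_component pq Bcq; apply.
apply: eq_bigl => f; apply/andP/pfamilyP=> [[/andP[hS /eqP hc] /eqP <-]|[fs fP]].
  split=> [|B BP]; first by apply/supportP=> B BnP; rewrite ffunE (negbTE BnP).
  by rewrite ffunE BP; apply: (component_struct hS); rewrite hc.
have fP' B : B \in P -> f B \in connected_structs B by exact: fP.
rewrite /h (glue_struct partP fP') (glue_components partP fP') eqxx; split=> //.
apply/eqP/ffunP=> B; rewrite ffunE; case: ifP => [BP|/negbT BnP].
  exact: (glue_restr partP fP' BP).
by move/supportP: fs => /(_ B BnP).
Qed.

End Components.

(** Induction on [#|S|]: the one-block partition contributes [c S], all others involve only smaller
    nonempty blocks. The value at [set0] never enters the formula, hence [S != set0]. *)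
Lemma cumulant_family_inj (R : numFieldType) r (E c c' : {set 'I_r} -> R) :
  cumulant_family E c -> cumulant_family E c' ->
  forall S, S != set0 -> c S = c' S.
Proof.
move=> Ec Ec' S; have [m] := ubnP #|S|; elim: m S => // m IHm S leSm S0.
have pS : partition [set S] S.
  apply: partitionI => [|B /set1P->|x xS|B C x /set1P-> /set1P->] //.
    by rewrite inE eq_sym.
  by exists S; rewrite ?set11.
have := Ec S; rewrite Ec' (bigD1 [set S]) // [in RHS](bigD1 [set S]) //=.
rewrite !big_set1 => eqS; apply/esym/(addIr _ (etrans eqS _)); congr (_ + _).
apply: eq_bigr => P /andP[pP PnS]; apply: eq_bigr => B BP.
apply: IHm; last exact: (partition_neq0 pP BP).
rewrite -ltnS; apply: leq_trans leSm; rewrite ltnS; apply: proper_card; rewrite properEneq (partitionS pP BP).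
rewrite andbT; apply: contra PnS => /eqP eBS; rewrite eq_sym; apply/eqP.
by apply: partition_sub_eq pS pP _; rewrite sub1set -eBS.
Qed.

(** * The Gram matrix *)

Lemma mem_pblockE (T : finType) (q : {set {set T}}) (D : {set T}) x y :
  partition q D ->
  reflect (exists B, [/\ B \in q, x \in B & y \in B]) (y \in pblock q x).
Proof.
move=> pq; have tq := partition_trivIset pq; apply: (iffP idP) => [yx|].
  have xq : x \in cover q.
    rewrite -mem_pblock; apply: contraLR yx => xnx.
    rewrite /pblock; case: pickP => [B /andP[Bq xB]|] /=; last by rewrite inE.
    by rewrite (def_pblock tq Bq xB) xB in xnx.
  by exists (pblock q x); rewrite pblock_mem // mem_pblock.
by case=> B [Bq xB yB]; rewrite (def_pblock tq Bq xB).
Qed.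

(** Functions constant along [e] are functions on the classes of [e]. Applied to the relation inside
    [pjoin], this reads a Gram entry as a number of functions. *)
Lemma card_ffun_connect (T V : finType) (e : rel T) :
  connect_sym e ->
  #|[set F : {ffun T -> V} | [forall x, forall y, e x y ==> (F x == F y)]]| =
  (#|V| ^ #|[set [set y | connect e x y] | x : T]|)%N.
Proof.
move=> esym; set J := [set _ | x : T]; pose B := {b | b \in J}.
pose blk x : B := exist _ [set y | connect e x y] (imset_f _ (erefl (x \in T))).
have ex (b : B) : exists x, blk x == b.
  by case: b => b bJ; have /imsetP[x _ ebx] := bJ; exists x; apply/eqP/val_inj.
have blkE x y : (blk x == blk y) = connect e x y.
  apply/eqP/idP => [/(congr1 val)/setP/(_ y)|cxy]; first by rewrite !inE connect0.
  by apply/val_inj/setP=> z; rewrite !inE; apply: same_connect.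
have -> : #|J| = #|{: B}| by rewrite card_sig.
rewrite -card_ffun -(card_imset (f := fun g : {ffun B -> V} => [ffun x => g (blk x)])).
  congr #|pred_of_set _|; apply/setP=> F; rewrite inE.
  apply/forallP/imsetP => [Fe|[g _ ->] x]; last first.
    apply/forallP=> y; apply/implyP=> exy; rewrite !ffunE.
    by have /eqP -> : blk x == blk y by rewrite blkE connect1.
  exists [ffun b => F (xchoose (ex b))] => //; apply/ffunP=> x; rewrite !ffunE.
  have := xchooseP (ex (blk x)); rewrite eq_sym blkE => /connectP[p].
  move: (xchoose _) => w.
  elim: p x => [|z p IHp] y /=; first by move=> _ ->.
  case/andP=> eyz pz lz; rewrite -(IHp z pz lz); apply/eqP.
  by have /forallP/(_ z)/implyP/(_ eyz) := Fe y.
move=> g g' egg'; apply/ffunP=> b; have /eqP <- := xchooseP (ex b).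
by move/ffunP/(_ (xchoose (ex b))): egg'; rewrite !ffunE.
Qed.

Lemma pblock_rel_sym (T : finType) (q : {set {set T}}) (D : {set T}) x y :
  partition q D -> (y \in pblock q x) = (x \in pblock q y).
Proof.
by move=> pq; apply/(mem_pblockE _ _ pq)/(mem_pblockE _ _ pq) => -[B [? ? ?]]; exists B.
Qed.

Definition refines (T : finType) (p q : {set {set T}}) :=
  [forall B in p, [exists C in q, B \subset C]].

Lemma mem_preim_partition (T : finType) (V : eqType) (F : T -> V) (D : {set T}) C x :
  C \in preim_partition F D -> x \in C -> C = [set y in D | F x == F y].
Proof.
case/imsetP=> z _ ->; rewrite inE => /andP[_ /eqP ->].
by apply/setP=> y; rewrite !inE.
Qed.

Lemma refines_preim (T : finType) (V : eqType) (F : T -> V) (p : {set {set T}}) :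
  partition p [set: T] ->
  refines p (preim_partition F [set: T]) =
  [forall x, forall y, (y \in pblock p x) ==> (F x == F y)].
Proof.
move=> pp; apply/'forall_implyP/forallP => [rp x|Fp B Bp].
  apply/forallP=> y; apply/implyP=> /(mem_pblockE _ _ pp)[B [Bp xB yB]].
  have /existsP[C /andP[CF /subsetP BC]] := rp B Bp.
  by have := BC y yB; rewrite (mem_preim_partition CF (BC x xB)) !inE => /andP[].
have /set0Pn[x xB] := partition_neq0 pp Bp.
apply/existsP; exists [set y in [set: T] | F x == F y].
rewrite imset_f ?inE //=; apply/subsetP=> y yB; rewrite !inE.
have /forallP/(_ y)/implyP := Fp x; apply.
by apply/(mem_pblockE _ _ pp); exists B.
Qed.

(** Each block of [q] is a disjoint union of blocks of [p]. Hence the kernel of a function constant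
    on the blocks of a partition in [Dk] is again in [Dk]. *)
Lemma refines_even (T : finType) (p q : {set {set T}}) :
  partition p [set: T] -> partition q [set: T] -> refines p q ->
  [forall B in p, ~~ odd #|B|] -> [forall C in q, ~~ odd #|C|].
Proof.
move=> pp pq /forall_inP rp /forall_inP ep; apply/forall_inP=> C Cq.
have pC : partition (p ::&: C) C.
  apply: partitionI => [|B|x xC|B B' x].
  - by rewrite inE (partition0 pp).
  - by rewrite !inE => /andP[].
  - have [B Bp xB] := partition_block pp (in_setT x).
    have /existsP[C' /andP[Cq' BC']] := rp B Bp.
    exists B => //; rewrite !inE Bp /=.
    by rewrite (block_eq pq Cq Cq' xC (subsetP BC' x xB)).
  - by rewrite !inE => /andP[Bq _] /andP[Bq' _]; apply: block_eq pp Bq Bq'.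
rewrite (card_partition pC); apply: (big_ind (fun m => ~~ odd m)) => //.
  by move=> a b; rewrite oddD => /negbTE-> /negbTE->.
by move=> B; rewrite inE => /andP[/ep].
Qed.

(* Grouping the [n ^ #|p \/ b|] functions constant on the blocks of [p] and [b]
   by their kernel [q] factors the Gram matrix as [Z * diag N * Z^T] with
   [N q = #{F | ker F = q}]; invertibility forces every [N q] to be nonzero. *)
Lemma gram_realizable (R : numFieldType) n K :
  gramD R n K \in unitmx ->
  forall q, q \in Dk K -> exists F : {ffun 'I_K -> 'I_n}, preim_partition F [set: 'I_K] = q.
Proof.
pose N q := #|[set F : {ffun 'I_K -> 'I_n} | preim_partition F [set: 'I_K] == q]|.
pose Z : 'M[R]_#|Dk K| := \matrix_(a, b) (refines (enum_val a) (enum_val b))%:R.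
pose D : 'rV[R]_#|Dk K| := \row_a (N (enum_val a))%:R.
have partD q : q \in Dk K -> partition q [set: 'I_K] by rewrite inE => /andP[].
have -> : gramD R n K = Z *m diag_mx D *m Z^T.
  apply/matrixP=> a b; rewrite mul_mx_diag !mxE.
  have [aD bD] := (enum_valP a, enum_valP b).
  set p := enum_val a; set p' := enum_val b; have [pp pp'] := (partD _ aD, partD _ bD).
  rewrite /pjoin; set e := [rel x y | _].
  have esym : connect_sym e.
    by apply: sym_connect_sym => x y; rewrite /= (pblock_rel_sym _ _ pp) (pblock_rel_sym _ _ pp').
  have eE (F : {ffun 'I_K -> 'I_n}) : [forall x, forall y, e x y ==> (F x == F y)] =
      refines p (preim_partition F [set: 'I_K]) && refines p' (preim_partition F [set: 'I_K]).
    rewrite !refines_preim //; apply/forallP/andP=> [Fe|[/forallP Fp /forallP Fp'] x].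
      split; apply/forallP=> x; apply/forallP=> y; apply/implyP=> xy;
        by have /forallP/(_ y)/implyP := Fe x; apply; rewrite /e /= xy ?orbT.
    apply/forallP=> y; apply/implyP=> /orP[] xy.
      by have /forallP/(_ y)/implyP := Fp x; apply.
    by have /forallP/(_ y)/implyP := Fp' x; apply.
  have := card_ffun_connect 'I_n esym; rewrite card_ord => nJ.
  rewrite -natrX -nJ -sum1_card natr_sum.
  rewrite (partition_big (fun F : {ffun 'I_K -> 'I_n} => preim_partition F [set: 'I_K])
    (fun q => q \in Dk K)) /=.
    rewrite big_enum_val; apply: eq_bigr => c _; rewrite !mxE.
    rewrite -/p -/p' mulrAC -natrM mulnb; set q := enum_val c.
    have [r|r] := boolP (refines p q && refines p' q).
      rewrite mul1r /N -sum1_card natr_sum; apply: eq_bigl => F.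
      by rewrite !inE eE; case: eqP => [->|]; rewrite ?andbF ?r.
    rewrite mul0r big1 // => F; rewrite inE eE => /andP[rF /eqP eF].
    by rewrite eF (negbTE r) in rF.
  move=> F; rewrite inE eE => /andP[rF _].
  rewrite inE preim_partitionP /=; apply: (refines_even pp _ rF); first exact: preim_partitionP.
  by move: aD; rewrite inE => /andP[].
rewrite !unitmx_mul => /andP[/andP[_ uD] _] q qD.
have : N q != 0%N.
  move: uD; rewrite unitmxE det_diag unitfE => /prodf_neq0/(_ (enum_rank_in qD q) isT).
  by rewrite mxE enum_rankK_in // pnatr_eq0.
by rewrite -lt0n => /card_gt0P[F]; rewrite inE => /eqP; exists F.
Qed.

(** * Joint moments *)

(** [tagnat] numbers the pairs of a cycle and an offset cycle after cycle, which agrees with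
    [off]. *)
Definition pos r (ks : 'I_r -> nat) i (t : 'I_(ks i)) : 'I_(tot ks) := @tagnat.Rank _ ks _ t.
Definition cycle_of r (ks : 'I_r -> nat) (x : 'I_(tot ks)) : 'I_r := tagnat.sig1 x.
Definition offset r (ks : 'I_r -> nat) (x : 'I_(tot ks)) : 'I_(ks (cycle_of x)) := tagnat.sig2 x.

Lemma pos_offset r (ks : 'I_r -> nat) (x : 'I_(tot ks)) : pos (offset x) = x.
Proof. exact: tagnat.sig2K. Qed.

Lemma cycle_of_pos r (ks : 'I_r -> nat) i (t : 'I_(ks i)) : cycle_of (pos t) = i.
Proof. exact: tagnat.Rank1K. Qed.

Lemma val_pos r (ks : 'I_r -> nat) i (t : 'I_(ks i)) : pos t = (off ks i + t)%N :> nat.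
Proof. exact: tagnat.RankEsum. Qed.

Lemma mem_cyc_block r (ks : 'I_r -> nat) i x :
  (x \in cyc_block ks i) = (cycle_of x == i).
Proof.
rewrite inE; apply/andP/eqP=> [[le_ix lt_xi]|<-].
  have lt_t : (x - off ks i < ks i)%N by rewrite ltn_subLR // ltnS.
  have -> : x = pos (Ordinal lt_t).
    by apply: ord_inj; rewrite val_pos /= subnKC.
  exact: cycle_of_pos.
rewrite -{2 3}[x]pos_offset val_pos.
by rewrite leq_addr ltn_add2l ltn_ord.
Qed.

Lemma gamma_Rank r (ks : 'I_r -> nat) i (t : 'I_(ks i)) :
  gamma_fun ks (pos t) = pos (ordS t).
Proof.
rewrite /gamma_fun; case: pickP => [j|/(_ i)]; rewrite mem_cyc_block cycle_of_pos.
  move=> /eqP <-; apply: ord_inj; rewrite val_insubd val_pos.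
  set m := (X in (X < tot ks)%N).
  (* At the last point of the cycle [t.+1 = ks i] and [ordS t] wraps to zero. The identity also
     bounds [m], so [insubd] does not fall back on its default. *)
  have em : m = pos (ordS t) :> nat.
    rewrite val_pos /m -addnS eqn_add2l /=.
    have := ltn_ord t; rewrite leq_eqVlt => /orP[/eqP eti|lti].
      by rewrite eti eqxx modnn addn0.
    by rewrite ltn_eqF // modn_small.
  by rewrite -/m em ltn_ord.
by rewrite eqxx.
Qed.

Lemma gamma_sig1 r (ks : 'I_r -> nat) (x : 'I_(tot ks)) :
  cycle_of (gamma_fun ks x) = cycle_of x.
Proof. by rewrite -[x]pos_offset gamma_Rank !cycle_of_pos. Qed.

Lemma gamma_inj r (ks : 'I_r -> nat) : injective (gamma_fun ks).
Proof.
move=> x y exy; have := congr1 (@cycle_of _ _) exy; rewrite !gamma_sig1.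
rewrite -[x]pos_offset -[y]pos_offset !cycle_of_pos in exy *.
move: (offset x) (offset y) exy => t u + etu.
case: _ / etu in u * => exy.
move: exy; rewrite !gamma_Rank => /tagnat.rank_inj/eqP.
by rewrite eq_Tagged => /eqP/ordS_inj ->.
Qed.

(** Distributivity for sums over different types: index functions on cycles of different lengths
    have different domains. *)
Lemma bigA_distr_fprod (R : comNzRingType) (I : finType) (T_ : I -> finType)
    (G : forall i, T_ i -> R) :
  \prod_i \sum_(f : T_ i) G i f = \sum_(t : fprod T_) \prod_i G i (t i).
Proof.
pose G' i := [ffun f => G i f].
transitivity (\sum_(t : fprod T_) \prod_(i in I) G' i (t i)); last first.
  by apply: eq_bigr => t _; apply: eq_bigr => i _; rewrite ffunE.
rewrite (@big_fprod R 0 1 *%R +%R I T_ G').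
(* All types are merged into one tagged type, where ordinary distributivity applies; [untag 0] gives
   zero off the right tag. *)
transitivity (\prod_i \sum_(j in tagged_with T_ i) untag 0 (G' i) j); last first.
  by rewrite bigA_distr_big_dep; apply: eq_bigl => g; apply: eq_forallb.
apply: eq_bigr => i _; rewrite -(big_tag (fun i => G' i)).
by apply: eq_bigr => f _; rewrite ffunE.
Qed.

Section CycleProducts.
Variables (R : numFieldType) (r : nat) (ks : 'I_r -> nat) (n : nat).
Local Notation X := 'I_(tot ks).

Definition unflatten (F : {ffun X -> 'I_n}) : fprod (fun i => {ffun 'I_(ks i) -> 'I_n}) :=
  [fprod i => [ffun t => F (pos t)]].

Definition flatten_fprod (f : fprod (fun i => {ffun 'I_(ks i) -> 'I_n})) : {ffun X -> 'I_n} :=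
  [ffun x => f (cycle_of x) (offset x)].

Lemma unflattenK : cancel unflatten flatten_fprod.
Proof. by move=> F; apply/ffunP=> x; rewrite ffunE fprodE ffunE pos_offset. Qed.

Lemma flattenK : cancel flatten_fprod unflatten.
Proof.
move=> f; apply/fprodP=> i; rewrite fprodE; apply/ffunP=> t; rewrite !ffunE.
pose G (u : {i & 'I_(ks i)}) : 'I_n := f (tag u) (tagged u).
exact: (congr1 G (tagnat.rankK (Tagged (fun i => 'I_(ks i)) t))).
Qed.

Variables (sigma : forall i : 'I_r, {set {set 'I_(ks i)}}) (y0 : 'I_n).

(* Off the cycles in [S], index functions are normalised to the dummy value [y0]. *)
Definition cycle_kernels (S : {set 'I_r}) (F : {ffun X -> 'I_n}) :=
  [forall i, if i \in S then ker_part [ffun t : 'I_(ks i) => F (pos t)] == sigma i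
             else [forall t : 'I_(ks i), F (pos t) == y0]].

(** Expanding the product glues index functions on the single cycles into one on all points. A cycle
    outside [S] contributes [1], written as a sum whose only term is the constant function [y0], so
    that all cycles are treated alike. *)
Lemma prod_Zfun (S : {set 'I_r}) (A : 'M[R]_n) :
  \prod_(i in S) Zfun (sigma i) A =
  \sum_(F : {ffun X -> 'I_n} | cycle_kernels S F)
    \prod_(x in fib (@cycle_of r ks) S) A (F x) (F (gamma_fun ks x)).
Proof.
pose Q i (f : {ffun 'I_(ks i) -> 'I_n}) :=
  if i \in S then ker_part f == sigma i else [forall t, f t == y0].
pose w i (f : {ffun 'I_(ks i) -> 'I_n}) :=
  if i \in S then \prod_s A (f s) (f (ordS s)) else 1.
transitivity (\prod_i \sum_(f : {ffun 'I_(ks i) -> 'I_n}) if Q i f then w i f else 0).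
  rewrite big_mkcond; apply: eq_bigr => i _; rewrite -big_mkcond /Q /w /=.
  case: ifP => _ //; rewrite (big_pred1 [ffun=> y0]) // => f.
  apply/forallP/eqP=> [fy|-> t]; last by rewrite ffunE.
  by apply/ffunP=> t; rewrite ffunE; apply/eqP.
rewrite bigA_distr_fprod (reindex unflatten); last first.
  by exists flatten_fprod => F _; rewrite ?unflattenK ?flattenK.
rewrite [RHS]big_mkcond; apply: eq_bigr => F _; case: ifP => [/forallP kF|/forallPn[i nkF]].
  transitivity (\prod_i w i (unflatten F i)).
    apply: eq_bigr => i _; have := kF i; rewrite /Q fprodE.
    case: ifP => // _; first by move=> ->.
    move=> /forallP Fy; case: forallP => // -[] t; rewrite ffunE; exact: Fy.
  rewrite /w -big_mkcond /= (sig_big_dep _ (fun i _ => true)).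
  rewrite [RHS](reindex (@tagnat.rank _ ks)) /=; last first.
    exact/onW_bij/tagnat.rank_bij.
  apply: eq_big => [[i t]|[i t] _]; first by rewrite /= andbT inE cycle_of_pos.
  by rewrite /= !fprodE !ffunE -[tagnat.rank _]/(pos t) gamma_Rank.
rewrite (bigD1 i) //= /Q fprodE; case: ifP nkF => _; first by move/negbTE->; rewrite mul0r.
move=> /forallPn[t nFt]; case: forallP => [/(_ t)|]; last by rewrite mul0r.
by rewrite ffunE (negbTE nFt).
Qed.

End CycleProducts.

(** * Permuting the values of functions with a given kernel *)

Lemma preim_partition_eqP (T : finType) (V W : eqType) (F : T -> V) (G : T -> W) (D : {set T}) :
  {in D &, forall x y, (F x == F y) = (G x == G y)} <->
  preim_partition F D = preim_partition G D.
Proof.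
split=> [FG|eFG x y xD yD].
  apply: eq_in_imset => x xD; apply/setP=> y; rewrite !inE.
  by have [yD|//] := boolP (y \in D); rewrite /= FG.
have xF : [set y in D | F x == F y] \in preim_partition G D by rewrite -eFG imset_f.
have xC : x \in [set y in D | F x == F y] by rewrite !inE xD eqxx.
by have /setP/(_ y) := mem_preim_partition xF xC; rewrite !inE yD.
Qed.

(** Equality of kernels makes [F x |-> G x] an injection on [F @: D]; the complements of its domain
    and image have equal size and are matched in enumeration order. *)
Lemma perm_extend (T X : finType) (D : {set X}) (F G : X -> T) :
  {in D &, forall x y, (F x == F y) = (G x == G y)} ->
  exists p : {perm T}, {in D, forall x, p (F x) = G x}.
Proof.
move=> FG; pose A := F @: D.
pose h v := if [pick x in D | F x == v] is Some x then G x else v.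
have hF : {in D, forall x, h (F x) = G x}.
  move=> x xD; rewrite /h; case: pickP => [y /andP[yD]|/(_ x)].
    by rewrite FG // => /eqP.
  by rewrite xD eqxx.
have hinj : {in A &, injective h}.
  move=> _ _ /imsetP[x xD ->] /imsetP[y yD ->]; rewrite !hF // => Gxy.
  by apply/eqP; rewrite FG ?Gxy.
have cA : size (enum (~: A)) = size (enum (~: (h @: A))).
  rewrite -!cardE; apply/eqP; rewrite -(eqn_add2l #|A|) cardsC.
  by rewrite -(card_in_imset hinj) cardsC.
pose p v := if v \in A then h v else nth v (enum (~: (h @: A))) (index v (enum (~: A))).
have pC v : v \notin A -> p v \notin h @: A.
  move=> vA; rewrite /p (negbTE vA) -in_setC -mem_enum mem_nth // -cA index_mem.
  by rewrite mem_enum inE.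
have pinj : injective p.
  move=> u v; have [uA|uA] := boolP (u \in A); have [vA|vA] := boolP (v \in A).
  - by rewrite /p uA vA; apply: hinj.
  - by move=> e; have := pC v vA; rewrite -e /p uA imset_f.
  - by move=> e; have := pC u uA; rewrite e /p vA imset_f.
  rewrite /p (negbTE uA) (negbTE vA).
  have iu : (index u (enum (~: A)) < size (enum (~: (h @: A))))%N.
    by rewrite -cA index_mem mem_enum inE.
  have iv : (index v (enum (~: A)) < size (enum (~: (h @: A))))%N.
    by rewrite -cA index_mem mem_enum inE.
  rewrite (set_nth_default v u iu) => /eqP; rewrite nth_uniq ?enum_uniq // => /eqP.
  by apply: (@index_inj _ u (enum (~: A))); rewrite mem_enum inE.
exists (perm pinj) => x xD; rewrite permE /p imset_f //; exact: hF.
Qed.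

Section Transport.
Variables (T X : finType) (D : {set X}) (y0 : T) (q : {set {set X}}).

(** Fixing [y0] off [D] lets a coloring stand for a function on [D] alone. *)
Definition colorings : {set {ffun X -> T}} :=
  [set F : {ffun X -> T} | (preim_partition F D == q) & [forall x, (x \notin D) ==> (F x == y0)]].

Implicit Types (F G : {ffun X -> T}) (p : {perm T}).

Lemma coloringsP F : reflect (preim_partition F D = q /\ forall x, x \notin D -> F x = y0)
  (F \in colorings).
Proof.
rewrite inE; apply: (iffP andP) => -[/eqP -> FD]; split=> //.
  by move=> x xD; have /forallP/(_ x)/implyP/(_ xD)/eqP := FD.
by apply/forallP=> x; apply/implyP=> /FD ->.
Qed.

Definition recolor (p : {perm T}) (F : {ffun X -> T}) : {ffun X -> T} :=
  [ffun x => if x \in D then p (F x) else y0].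

Lemma recolor_colorings p F : F \in colorings -> recolor p F \in colorings.
Proof.
move=> /coloringsP[Fq _]; apply/coloringsP; split=> [|x xD]; last first.
  by rewrite ffunE (negbTE xD).
rewrite -Fq; apply/preim_partition_eqP => x y xD yD.
by rewrite !ffunE xD yD (inj_eq perm_inj).
Qed.

Lemma recolor_trans F G : F \in colorings -> G \in colorings ->
  exists p, recolor p F = G.
Proof.
move=> /coloringsP[Fq _] /coloringsP[Gq GD].
have [|p pF] := @perm_extend T X D F G.
  by apply/preim_partition_eqP; rewrite Fq Gq.
exists p; apply/ffunP=> x; rewrite ffunE; case: ifPn => xD; first exact: pF.
by rewrite GD.
Qed.

Lemma recolor_comp p p' F : recolor p' (recolor p F) = recolor (p * p')%g F.
Proof. by apply/ffunP=> x; rewrite !ffunE; case: ifP => // xD; rewrite xD permM. Qed.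

(* The permutations act transitively on [colorings], so the number of [p]
   sending one coloring to another does not depend on the target. *)
Lemma sum_card_recolor (G : {ffun X -> T} -> {ffun X -> T}) :
  colorings != set0 -> (forall F, F \in colorings -> G F \in colorings) ->
  (\sum_(F in colorings) #|[set p | recolor p F == G F]| = #|{: {perm T}}|)%N.
Proof.
move=> /set0Pn[F0 F0O] GO.
pose a F F' := #|[set p | recolor p F == F']|.
(* [p1 |-> p1 * p0] maps the stabiliser of [F] onto the permutations carrying [F] to [F']. *)
have aE F F' : F \in colorings -> F' \in colorings -> a F F' = a F F.
  move=> FO F'O; have [p0 ep0] := recolor_trans FO F'O.
  rewrite /a -[RHS](card_imset _ (mulIg p0)); congr #|pred_of_set _|; apply/setP=> p.
  rewrite inE; apply/eqP/imsetP=> [ep|[p1]]; last first.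
    by rewrite inE => /eqP ep1 ->; rewrite -recolor_comp ep1.
  exists (p * p0^-1)%g; last by rewrite mulgKV.
  rewrite inE -recolor_comp ep -ep0 recolor_comp mulgV; apply/eqP/ffunP=> x.
  rewrite ffunE perm1; case: ifPn => // xD; by have /coloringsP[_ /(_ x xD) ->] := FO.
(* Every permutation carries [F] to exactly one coloring, so the equal counts add up to the whole
   group. *)
have sumF F : F \in colorings -> (#|colorings| * a F F)%N = #|{: {perm T}}|.
  move=> FO; rewrite -sum_nat_const -(eq_bigr _ (fun F' F'O => aE F F' FO F'O)).
  rewrite -[RHS]sum1_card (partition_big (recolor^~ F) (mem colorings)) /=; last first.
    by move=> p _; apply: recolor_colorings.
  by apply: eq_bigr => F' _; rewrite /a -sum1_card; apply: eq_bigl => p; rewrite inE.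
(* After multiplication by [#|colorings|] every summand equals the order of the group. *)
apply/eqP; have cO : (0 < #|colorings|)%N by apply/card_gt0P; exists F0.
rewrite -(eqn_pmul2l cO) big_distrr /= -sum_nat_const; apply/eqP/eq_bigr => F FO.
by rewrite -(sumF F FO) -(aE F (G F)) // GO.
Qed.

End Transport.

(** * Averaging over signs and permutations *)

Lemma sum_signs (R : numFieldType) (X : finType) n (D : {set X}) (F : {ffun X -> 'I_n}) :
  \sum_(eps : {ffun 'I_n -> bool}) \prod_(x in D) (-1) ^+ eps (F x) =
  (2 ^ n * [forall C in preim_partition F D, ~~ odd #|C|])%:R :> R.
Proof.
pose m v := #|[set x in D | F x == v]|.
transitivity (\sum_(eps : {ffun 'I_n -> bool}) \prod_v (((-1) ^+ eps v) ^+ m v : R)).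
  apply: eq_bigr => eps _.
  rewrite (partition_big F predT) //=; apply: eq_bigr => v _.
  rewrite (eq_bigr (fun=> (-1) ^+ eps v)) => [|x /andP[_ /eqP ->] //].
  by rewrite prodr_const; congr (_ ^+ _); apply: eq_card => x; rewrite !inE.
(* Signs at distinct values are independent; a fibre of size [m v] yields the factor
   [(-1) ^+ m v + 1], which is 2 or 0. *)
rewrite -(bigA_distr_bigA (fun v b => (((-1) ^+ (b : bool)) ^+ m v : R))).
under eq_bigr do rewrite big_bool /= expr1 expr0 expr1n.
case: forall_inP => [ev|nev].
  rewrite (eq_bigr (fun=> 2)) => [|v _]; first by rewrite prodr_const card_ord muln1 natrX.
  rewrite -signr_odd; suff /negbTE-> : ~~ odd (m v) by [].
  have [x /andP[xD /eqP <-]|m0] := pickP [pred x in D | F x == v].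
    rewrite /m (_ : [set y in D | _] = [set y in D | F x == F y]); last first.
      by apply/setP=> y; rewrite !inE eq_sym.
    by apply: ev; rewrite imset_f.
  (* A value not taken on [D] has an empty, hence even, fibre. *)
  rewrite /m (_ : [set y in D | _] = set0) ?cards0 //.
  by apply/setP=> y; rewrite !inE; apply: m0.
suff [v ov] : exists v, odd (m v).
  by rewrite muln0 (bigD1 v) //= -signr_odd ov expr1 addNr mul0r.
apply/existsP; apply: contra_notT nev => /existsPn em _ /imsetP[x xD ->].
by have := em (F x); rewrite /m; congr (~~ odd #|pred_of_set _|); apply/setP=> y; rewrite !inE eq_sym.
Qed.

(** The block of [x] is carried onto the block of [g x]: invariance of the kernel becomes equality
    of the kernels of [F] and [F \o g], the form to which transitivity applies. *)
Lemma preim_partition_invariantP (X : finType) (V : eqType) (D : {set X}) (g : X -> X) (F : X -> V) :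
  injective g -> (forall x, (g x \in D) = (x \in D)) ->
  reflect {in D &, forall x y, (F (g x) == F (g y)) = (F x == F y)}
    [forall C in preim_partition F D, g @: C \in preim_partition F D].
Proof.
move=> gI gD; set q := preim_partition F D.
have blk x : x \in D -> [set y in D | F x == F y] \in q by move=> xD; apply: imset_f.
apply: (iffP forall_inP) => [qg x y xD yD|Fg _ /imsetP[x xD ->]].
  have gx : g x \in g @: [set y in D | F x == F y] by rewrite imset_f // !inE xD eqxx.
  have /setP/(_ (g y)) := mem_preim_partition (qg _ (blk x xD)) gx.
  by rewrite mem_imset // !inE gD yD.
rewrite (_ : g @: _ = [set y in D | F (g x) == F y]) ?blk ?gD //.
have [g' _ g'K] := injF_bij gI.
apply/setP=> z; rewrite -[z]g'K mem_imset // !inE gD.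
by have [zD|//] := boolP (g' z \in D); rewrite Fg.
Qed.

Lemma restr_cycleE r (ks : 'I_r -> nat) (q : {set {set 'I_(tot ks)}}) i :
  restr_cycle ks q i =
  [set [set t : 'I_(ks i) | pos t \in B] | B : {set 'I_(tot ks)} in q] :\ set0.
Proof.
rewrite /restr_cycle; congr (_ :\ _); apply: eq_imset => B; apply/setP=> t; rewrite !inE.
apply/existsP/idP=> [[x /andP[xB /eqP ex]]|tB]; last first.
  by exists (pos t); rewrite tB; apply/eqP/val_pos.
by rewrite (_ : pos t = x) //; apply: ord_inj; rewrite val_pos.
Qed.

(** An entry is a sign times an indicator depending on the permutation only; the permutations that
    survive all share the same sign sum. *)
Lemma sum_spmx (R : numFieldType) (X : finType) n (D : {set X}) (F G : {ffun X -> 'I_n}) :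
  \sum_(s : sp_index n) \prod_(x in D) (spmx s (F x) (G x) : R) =
  (#|[set p : 'S_n | [forall x in D, p (F x) == G x]]| *
   (2 ^ n * [forall C in preim_partition F D, ~~ odd #|C|]))%:R.
Proof.
pose w (p : 'S_n) (eps : {ffun 'I_n -> bool}) : R :=
  \prod_(x in D) (if p (F x) == G x then (-1) ^+ eps (F x) else 0).
transitivity (\sum_(s : sp_index n) w s.1 s.2).
  by apply: eq_bigr => s _; apply: eq_bigr => x _; rewrite mxE.
rewrite -(pair_bigA _ w) /= natrM -sum1_card natr_sum big_distrl /= [RHS]big_mkcond.
apply: eq_bigr => p _; rewrite inE; case: forall_inP => [pF|npF].
  rewrite mul1r -sum_signs; apply: eq_bigr => eps _.
  by apply: eq_bigr => x xD; rewrite pF.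
rewrite big1 // => eps _.
have /forall_inPn[x xD nx] : ~~ [forall x in D, p (F x) == G x] by apply/forall_inP.
by rewrite /w (bigD1 x) //= (negbTE nx) mul0r.
Qed.

Section Moments.
Variables (R : numFieldType) (r : nat) (ks : 'I_r -> nat) (n : nat).
Variables (sigma : forall i : 'I_r, {set {set 'I_(ks i)}}).
Local Notation X := 'I_(tot ks).
Local Notation fibs := (fib (@cycle_of r ks)).

(** Evenness and invariance are demanded only of blocks meeting cycle [i], which makes the condition
    local. *)
Definition cycle_cond (i : 'I_r) (q : {set {set X}}) :=
  (restr_cycle ks q i == sigma i) &&
  [forall C in q, [exists x in C, cycle_of x == i] ==>
     (~~ odd #|C|) && (gamma_fun ks @: C \in q)].

Local Notation structs := (structs (@cycle_of r ks) cycle_cond).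

(** Every block over [S] is nonempty, hence meets some cycle of [S], so the local conditions add up
    to global ones. *)
Lemma mem_structs (S : {set 'I_r}) q :
  (q \in structs S) =
  [&& partition q (fibs S), [forall i in S, restr_cycle ks q i == sigma i],
      [forall C in q, ~~ odd #|C|] & [forall C in q, gamma_fun ks @: C \in q]].
Proof.
rewrite inE; case: (boolP (partition _ _)) => //= pq.
apply/forall_inP/and3P=> [qS|[/forall_inP qr /forall_inP qe /forall_inP qg] i iS].
  have qC C : C \in q -> (~~ odd #|C|) && (gamma_fun ks @: C \in q).
    move=> Cq; have /set0Pn[x xC] := partition_neq0 pq Cq.
    have := subsetP (partitionS pq Cq) x xC; rewrite inE => /qS/andP[_].
    move=> /forall_inP/(_ C Cq)/implyP; apply.
    by apply/existsP; exists x; rewrite xC eqxx.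
  split; first by apply/forall_inP=> i /qS/andP[].
    by apply/forall_inP=> C /qC/andP[].
  by apply/forall_inP=> C /qC/andP[].
rewrite /cycle_cond qr //=; apply/forall_inP=> C Cq; apply/implyP=> _.
by rewrite qe // qg.
Qed.

Lemma restr_preim (S : {set 'I_r}) (F : {ffun X -> 'I_n}) i : i \in S ->
  restr_cycle ks (preim_partition F (fibs S)) i =
  ker_part [ffun t : 'I_(ks i) => F (pos t)].
Proof.
move=> iS; rewrite restr_cycleE.
have posS (t : 'I_(ks i)) : pos t \in fibs S by rewrite inE cycle_of_pos.
have blk (s : 'I_(ks i)) : [set t : 'I_(ks i) | pos t \in [set y in fibs S | F (pos s) == F y]] =
    [set t | [ffun t : 'I_(ks i) => F (pos t)] t == [ffun t : 'I_(ks i) => F (pos t)] s].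
  apply/setP=> t; rewrite !inE cycle_of_pos iS /= !ffunE; exact: eq_sym.
apply/setP=> C; rewrite !inE; apply/andP/imsetP=> [[C0 /imsetP[B Bq eC]]|[s _ ->]].
  have /set0Pn[s] := C0; rewrite eC inE => sB.
  by exists s => //; rewrite -blk -(mem_preim_partition Bq sB).
split; first by apply/set0Pn; exists s; rewrite inE eqxx.
rewrite -blk; apply/imsetP; exists [set y in fibs S | F (pos s) == F y] => //.
exact: imset_f.
Qed.

Lemma gamma_fib (S : {set 'I_r}) x : (gamma_fun ks x \in fibs S) = (x \in fibs S).
Proof. by rewrite !inE gamma_sig1. Qed.

(** For an invariant kernel the counts of matching permutations, summed over the colorings, give the
    order of ['S_n]; with the [2 ^ n] signs this is the group order, which the normalisation
    cancels. *)
Lemma moment_structs (S : {set 'I_r}) : (0 < n)%N ->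
  (forall q, q \in structs S -> exists F : {ffun X -> 'I_n}, preim_partition F (fibs S) = q) ->
  haar_Hn n (fun A : 'M[R]_n => \prod_(i in S) Zfun (sigma i) A) = #|structs S|%:R.
Proof.
move=> n0 real; pose y0 := Ordinal n0; pose D : {set X} := fibs S.
pose G (F : {ffun X -> 'I_n}) : {ffun X -> 'I_n} := [ffun x => F (gamma_fun ks x)].
(* Resetting to [y0] off [D] makes [G0] map colorings to colorings when the kernel is invariant. *)
pose G0 (F : {ffun X -> 'I_n}) : {ffun X -> 'I_n} := [ffun x => if x \in D then F (gamma_fun ks x) else y0].
pose N (F : {ffun X -> 'I_n}) := #|[set p : 'S_n | recolor D y0 p F == G0 F]|.
pose ok (q : {set {set X}}) := [&& partition q D, [forall i in S, restr_cycle ks q i == sigma i] &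
                 [forall C in q, ~~ odd #|C|]].
have ckE (F : {ffun X -> 'I_n}) : cycle_kernels sigma y0 S F =
    (F \in colorings D y0 (preim_partition F D)) &&
    [forall i in S, restr_cycle ks (preim_partition F D) i == sigma i].
  rewrite inE eqxx /=; apply/forallP/andP=> [kF|[/forallP FD /forall_inP Fs] i].
    split; apply/forallP=> z; apply/implyP=> zS; have := kF; last first.
      by move=> /(_ z); rewrite zS restr_preim.
    move=> /(_ (cycle_of z)); rewrite inE in zS; rewrite (negbTE zS).
    by move=> /forallP/(_ (offset z)); rewrite pos_offset.
  case: ifPn => iS; first by rewrite -(restr_preim _ iS) Fs.
  apply/forallP=> t; have /implyP := FD (pos t); apply.
  by rewrite inE cycle_of_pos.
have NE (F : {ffun X -> 'I_n}) : #|[set p : 'S_n | [forall x in D, p (F x) == G F x]]| = N F.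
  rewrite /N; congr #|pred_of_set _|; apply/setP=> p; rewrite !inE.
  apply/forall_inP/eqP=> [pF|/ffunP pF x xD].
    by apply/ffunP=> x; rewrite !ffunE; case: ifP => // /pF/eqP; rewrite ffunE.
  by have := pF x; rewrite !ffunE xD => ->.
rewrite /haar_Hn; under eq_bigr do rewrite (prod_Zfun sigma y0).
rewrite exchange_big /=.
transitivity ((#|{: sp_index n}|%:R)^-1 * \sum_(q | ok q)
    \sum_(F in colorings D y0 q) (N F * 2 ^ n)%:R : R).
  congr (_ * _); rewrite (partition_big (fun F : {ffun X -> 'I_n} => preim_partition F D)
    (fun q => partition q D)) /=; last by move=> F _; apply: preim_partitionP.
  rewrite big_mkcond [RHS]big_mkcond; apply: eq_bigr => q _; rewrite /ok.
  case: ifP => //= pq; rewrite big_mkcond.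
  rewrite (_ : (if _ then _ else _) = \sum_(F in colorings D y0 q) 
     if [forall i in S, restr_cycle ks q i == sigma i] && [forall C in q, ~~ odd #|C|]
       then (N F * 2 ^ n)%:R else 0); last by case: ifP => // _; rewrite big1.
  rewrite [RHS]big_mkcond; apply: eq_bigr => F _; rewrite ckE.
  have [eq|neq] := eqVneq (preim_partition F D) q; last first.
    by rewrite andbF [F \in colorings _ _ q]inE (negbTE neq).
  rewrite eq andbT; case: (F \in _) => //=; case: ifP => //= _.
  rewrite (eq_bigr (fun s => \prod_(x in D) (spmx s (F x) (G F x) : R))) => [|s _].
    by rewrite sum_spmx NE eq; case: ifP => _; rewrite ?muln1 ?muln0.
  by apply: eq_bigr => x _; rewrite ffunE.
rewrite (eq_bigr (fun q => (q \in structs S)%:R * #|{: sp_index n}|%:R)) => [|q /and3P[pq rq eq]].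
  have cG0 : (#|{: sp_index n}|%:R : R) != 0.
    by rewrite pnatr_eq0 -lt0n; apply/card_gt0P; exists (1%g, [ffun=> false]).
  rewrite -big_distrl /= mulrC mulfK // -natr_sum -sum1_card; congr (_ %:R).
  rewrite [RHS]big_mkcond [LHS]big_mkcond; apply: eq_bigr => q _.
  by rewrite mem_structs /ok; do 3!case: (X in X && _) => //=; case: ifP.
have gI := @gamma_inj r ks; have gD := gamma_fib S.
rewrite -natr_sum -natrM -big_distrl /=; congr (_ %:R).
have cG : #|{: sp_index n}| = (#|{: 'S_n}| * 2 ^ n)%N.
  by rewrite card_prod card_ffun card_bool card_ord.
have [qS|nqS] := boolP (q \in structs S).
  rewrite mul1n cG; congr (_ * _)%N; apply: sum_card_recolor.
    have [F eF] := real q qS; apply/set0Pn.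
    exists [ffun x => if x \in D then F x else y0]; apply/coloringsP; split.
      rewrite -eF; apply/preim_partition_eqP => x y xD yD.
      by rewrite !ffunE -/D xD yD.
    by move=> x xD; rewrite ffunE (negbTE xD).
  move=> F /coloringsP[eF _]; apply/coloringsP; split; last first.
    by move=> x xD; rewrite ffunE (negbTE xD).
  rewrite -[RHS]eF; apply/preim_partition_eqP => x y xD yD; rewrite !ffunE xD yD.
  move: x y xD yD; apply/(preim_partition_invariantP F gI gD).
  by rewrite eF; move: qS; rewrite mem_structs => /and4P[].
(* A permutation carrying [F] to [G0 F] would force equal kernels, and [q] would be invariant. *)
rewrite mul0n big1 // => F /coloringsP[eF _]; apply/eqP; rewrite cards_eq0.
apply: contraR nqS => /set0Pn[p]; rewrite inE => /eqP/ffunP pF.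
rewrite mem_structs pq rq eq /= -eF.
apply/(preim_partition_invariantP F gI gD) => x y xD yD.
have := pF x; have := pF y; rewrite !ffunE -/D in xD yD *; rewrite xD yD => <- <-.
by rewrite (inj_eq perm_inj).
Qed.

End Moments.

(** * Cumulants *)

(** By saturation a block meeting cycle [i] lies over [S], and [gamma_fun] keeps its image there, so
    the restriction loses nothing that cycle [i] sees. *)
Lemma cycle_cond_restr r (ks : 'I_r -> nat) (sigma : forall i : 'I_r, {set {set 'I_(ks i)}})
    i (S : {set 'I_r}) (q : {set {set 'I_(tot ks)}}) :
  i \in S -> saturated (@cycle_of r ks) q S ->
  cycle_cond sigma i (q ::&: fib (@cycle_of r ks) S) = cycle_cond sigma i q.
Proof.
move=> iS /saturatedP sq; have sub B x : B \in q -> x \in B -> cycle_of x = i ->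
    B \subset fib (@cycle_of r ks) S.
  move=> Bq xB xi; apply/subsetP=> y yB; rewrite inE; apply: (sq B x) => //.
  by rewrite xi.
rewrite /cycle_cond !restr_cycleE; congr (_ && _).
  congr (_ == _); apply/setP=> C; rewrite !inE; case: eqP => //= /eqP C0.
  apply/imsetP/imsetP=> -[B Bq eC]; exists B => //.
    by move: Bq; rewrite !inE => /andP[].
  move: C0; rewrite eC => /set0Pn[t]; rewrite inE => tB.
  by rewrite !inE Bq (sub _ _ Bq tB) // cycle_of_pos.
have gsub C x : C \in q -> x \in C -> cycle_of x = i ->
    gamma_fun ks @: C \subset fib (@cycle_of r ks) S.
  move=> Cq xC xi; apply/subsetP=> _ /imsetP[y yC ->]; rewrite gamma_fib.
  exact: (subsetP (sub _ _ Cq xC xi)).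
apply/forall_inP/forall_inP=> qC C.
  move=> Cq; apply/implyP=> Ci; have /existsP[x /andP[xC /eqP xi]] := Ci.
  have := qC C; rewrite !inE Cq (sub C x) //= Ci /= => /(_ isT)/andP[-> /andP[->]] //.
rewrite !inE => /andP[Cq CS]; apply/implyP=> Ci; have /existsP[x /andP[xC /eqP xi]] := Ci.
by have := qC C Cq; rewrite Ci (gsub C x) //= andbT.
Qed.

(** Flipping all signs is an involution of the parameter set that turns [spmx g] into its
    negative. *)
Lemma haar_opp (R : numFieldType) n (f : 'M[R]_n -> R) :
  haar_Hn n (fun A => f (- A)) = haar_Hn n f.
Proof.
rewrite /haar_Hn; congr (_ * _).
pose h (g : sp_index n) : sp_index n := (g.1, [ffun i => ~~ g.2 i]).
have hK : involutive h.
  by case=> p eps; congr (_, _); apply/ffunP=> i; rewrite !ffunE negbK.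
rewrite [RHS](reindex_inj (inv_inj hK)); apply: eq_bigr => g _; congr (f _).
apply/matrixP=> i j; rewrite !mxE /= ffunE; case: ifP; rewrite ?oppr0 // => _.
by case: (g.2 i); rewrite ?opprK.
Qed.

Lemma Zfun_opp (R : numFieldType) n l (s : {set {set 'I_l}}) (A : 'M[R]_n) :
  Zfun s (- A) = (-1) ^+ l * Zfun s A.
Proof.
rewrite /Zfun big_distrr; apply: eq_bigr => f _ /=; rewrite /u_coord.
under eq_bigr do rewrite mxE.
by rewrite prodrN card_ord.
Qed.

(* The family [S |-> (-1)^(k_S) c S] has the same moments, so it equals [c]. *)
Lemma odd_cumulant (R : numFieldType) r (ks : 'I_r -> nat) (E c : {set 'I_r} -> R) :
  (forall S, E S = (-1) ^+ (\sum_(i in S) ks i)%N * E S) ->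
  cumulant_family E c ->
  forall S, S != set0 -> odd (\sum_(i in S) ks i) -> c S = 0.
Proof.
move=> Eodd Ec S S0 oS.
have Ec' : cumulant_family E (fun S => (-1) ^+ (\sum_(i in S) ks i)%N * c S).
  (* The exponents of the blocks add up to that of [T], so the sign is multiplicative over
     blocks. *)
  move=> T; rewrite Eodd Ec big_distrr; apply: eq_bigr => P pP /=.
  rewrite big_split /=; congr (_ * _).
  by rewrite (set_partition_big _ pP) -expr_sum.
have := cumulant_family_inj Ec Ec' S0.
by rewrite -signr_odd oS expr1 mulN1r => /eqP; rewrite -addr_eq0 -mulr2n mulrn_eq0 => /eqP.
Qed.

Lemma preim_partition_sub (T : finType) (V : eqType) (F : T -> V) (q : {set {set T}}) (D : {set T}) :
  partition q D -> q \subset preim_partition F [set: T] -> preim_partition F D = q.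
Proof.
move=> pq /subsetP qF; apply/esym/(partition_sub_eq pq (preim_partitionP _ _)).
apply/subsetP=> C Cq; have /set0Pn[x xC] := partition_neq0 pq Cq.
have CD := subsetP (partitionS pq Cq); apply/imsetP; exists x; first exact: CD.
apply/setP=> y; rewrite !inE [in LHS](mem_preim_partition (qF C Cq) xC) !inE /=.
have [//|yD] := boolP (y \in D); apply: contraNF yD => Fxy; apply: CD.
by rewrite (mem_preim_partition (qF C Cq) xC) !inE.
Qed.

(** The complement of [D] has even size because [K] and all blocks of [q] do, so it can be added as
    one block. This brings partitions of a union of cycles under the Gram hypothesis. *)
Lemma extend_Dk K (D : {set 'I_K}) (q : {set {set 'I_K}}) :
  ~~ odd K -> partition q D -> [forall C in q, ~~ odd #|C|] ->
  exists2 p, p \in Dk K & q \subset p.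
Proof.
move=> eK pq /forall_inP eq.
have eD : ~~ odd #|D|.
  rewrite (card_partition pq); apply: (big_ind (fun m => ~~ odd m)) => //.
  by move=> a b; rewrite oddD => /negbTE-> /negbTE->.
have [DT|DT] := eqVneq (~: D) set0.
  exists q => //; rewrite inE; apply/andP; split; last exact/forall_inP.
  by rewrite -(setCK D) DT setC0 in pq.
exists (~: D |: q); last exact: subsetUr.
rewrite inE -(setUCr D) [D :|: _]setUC partitionU1 //=; last by rewrite -setI_eq0 setIC setICr.
apply/forall_inP=> C /setU1P[->|/eq //].
by move: eK; rewrite -{1}(card_ord K) -(cardsC D) oddD (negbTE eD).
Qed.

Lemma gamma_part_partition r (ks : 'I_r -> nat) :
  (forall i, 0 < ks i)%N -> partition (gamma_part ks) [set: 'I_(tot ks)].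
Proof.
move=> ks0; apply: partitionI => [|B|x _|B C x /imsetP[i _ ->] /imsetP[j _ ->]] //.
- apply/negP=> /imsetP[i _ /setP/(_ (pos (Ordinal (ks0 i))))].
  by rewrite mem_cyc_block cycle_of_pos eqxx inE.
- exists (cyc_block ks (cycle_of x)); first exact: imset_f.
  by rewrite mem_cyc_block.
- by rewrite !mem_cyc_block => /eqP -> /eqP ->.
Qed.

Lemma mem_pblock_gamma r (ks : 'I_r -> nat) (x y : 'I_(tot ks)) :
  (forall i, 0 < ks i)%N ->
  (y \in pblock (gamma_part ks) x) = (cycle_of x == cycle_of y).
Proof.
move=> ks0; apply/(mem_pblockE _ _ (gamma_part_partition ks0))/eqP.
  by case=> _ [/imsetP[i _ ->]]; rewrite !mem_cyc_block => /eqP -> /eqP ->.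
move=> exy; exists (cyc_block ks (cycle_of x)).
by rewrite !mem_cyc_block exy eqxx imset_f.
Qed.

(** [gamma_fun] acts injectively on blocks, so an inclusion of [gamma_act ks q] in [q] is an
    equality by cardinality. *)
Lemma gamma_act_fixed r (ks : 'I_r -> nat) (q : {set {set 'I_(tot ks)}}) :
  (gamma_act ks q == q) = [forall C in q, gamma_fun ks @: C \in q].
Proof.
apply/eqP/forall_inP=> [gq C Cq|gq]; first by rewrite -gq imset_f.
apply/eqP; rewrite eqEcard (card_imset _ (imset_inj (@gamma_inj r ks))) leqnn andbT.
by apply/subsetP=> _ /imsetP[C Cq ->]; apply: gq.
Qed.

(** Moves within a cycle are free in the join with [gamma_part], so paths of points project to paths
    of cycles and lift back. *)
Lemma pjoin_gamma_top r (ks : 'I_r -> nat) (q : {set {set 'I_(tot ks)}}) :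
  (0 < r)%N -> (forall i, 0 < ks i)%N -> partition q [set: 'I_(tot ks)] ->
  (pjoin q (gamma_part ks) == [set [set: 'I_(tot ks)]]) =
  [forall i, forall j, connect (link (@cycle_of r ks) q) i j].
Proof.
move=> r0 ks0 pq; rewrite /pjoin; set e := [rel x y | _].
pose pt i := pos (Ordinal (ks0 i)).
transitivity [forall x, forall y, connect e x y].
  apply/eqP/forallP=> [J x|ce].
    have : [set y | connect e x y] \in [set [set: 'I_(tot ks)]] by rewrite -J imset_f.
    by rewrite inE => /eqP/setP cx; apply/forallP=> y; have := cx y; rewrite !inE.
  have cx x : [set y | connect e x y] = setT.
    by apply/setP=> y; rewrite !inE; have /forallP := ce x; apply.
  apply/setP=> B; rewrite inE; apply/imsetP/eqP=> [[x _ ->]|->]; first exact: cx.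
  by exists (pt (Ordinal r0)).
have cyc x y : cycle_of x = cycle_of y -> connect e x y.
  by move=> exy; apply: connect1; rewrite /e /= mem_pblock_gamma // exy eqxx orbT.
apply/forallP/forallP=> [ce i|cl x].
  apply/forallP=> j; have /forallP/(_ (pt j))/connectP[p ep lp] := ce (pt i).
  suff: connect (link (@cycle_of r ks) q) (cycle_of (pt i)) (cycle_of (pt j)).
    by rewrite !cycle_of_pos.
  move: ep lp; move: (pt i) (pt j) =>  x y; elim: p x => [|z p IHp] x /=; first by move=> _ ->.
  case/andP=> exz pp ly; apply: connect_trans (IHp z pp ly).
  case/orP: exz => [/(mem_pblockE _ _ pq)[B [Bq xB zB]]|].
    by apply: connect1; apply/linkP; exists B, x, z.
  by rewrite mem_pblock_gamma // => /eqP ->.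
apply/forallP=> y; have /forallP/(_ (cycle_of y))/connectP[p] := cl (cycle_of x).
have: cycle_of x = cycle_of x by [].
move: {2 3 4}(cycle_of x) => i; elim: p i x => [|j p IHp] i x /=.
  by move=> <- _ lxy; apply: cyc.
move=> xi /andP[/linkP[C [x' [z [Cq xC zC xi' zj]]]] pp] ly.
apply: connect_trans (IHp j z zj pp ly).
(* The lifted path first moves inside the cycle of [x] to the point [x'] of the linking block [C],
   then through [C] to [z]. *)
apply: (@connect_trans _ _ x'); first by apply: cyc; rewrite xi xi'.
by apply: connect1; apply/orP; left; apply/(mem_pblockE _ _ pq); exists C.
Qed.

Theorem theorem7p3 (R : realFieldType) (r : nat) (ks : 'I_r -> nat)
    (sigma : forall i : 'I_r, {set {set 'I_(ks i)}}) (n : nat)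
    (c : {set 'I_r} -> R) :
  (0 < r)%N ->
  (forall i, 0 < ks i)%N ->
  (forall i, partition (sigma i) [set: 'I_(ks i)]) ->
  gramD R n (tot ks) \in unitmx ->
  cumulant_family
    (fun S : {set 'I_r} =>
       haar_Hn n (fun A : 'M[R]_n => \prod_(i in S) Zfun (sigma i) A)) c ->
  c [set: 'I_r] =
  (#|[set q in Dk (tot ks) |
        [&& gamma_act ks q == q,
            pjoin q (gamma_part ks) == [set [set: 'I_(tot ks)]] &
            [forall i : 'I_r, restr_cycle ks q i == sigma i]]]|)%:R.
Proof.
move=> r0 ks0 _ uG Ec; pose kap := @cycle_of r ks; pose loc := cycle_cond sigma.
have T0 : [set: 'I_r] != set0 by apply/set0Pn; exists (Ordinal r0).
have [oK|eK] := boolP (odd (tot ks)).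
  rewrite (odd_cumulant (ks := ks) _ Ec T0); last first.
  - by rewrite (eq_bigl xpredT) // => i; rewrite inE.
  - move=> S /=; rewrite -[LHS]haar_opp /haar_Hn mulrCA; congr (_ * _).
    rewrite big_distrr; apply: eq_bigr => g _ /=.
    under eq_bigr do rewrite Zfun_opp.
    by rewrite big_split expr_sum.
  rewrite (_ : [set q in _ | _] = set0) ?cards0 //; apply/setP=> q; rewrite inE in_set0.
  apply: contraTF oK => /andP[]; rewrite inE => /andP[pq /forall_inP eq] _.
  rewrite -(card_ord (tot ks)) -cardsT (card_partition pq).
  apply: (big_ind (fun m => ~~ odd m)) => //.
  by move=> a b; rewrite oddD => /negbTE-> /negbTE->.
have fibT : fib kap setT = setT by apply/setP=> x; rewrite !inE.
have K0 : 'I_(tot ks) by exact: (pos (Ordinal (ks0 (Ordinal r0)))).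
have realize S q : q \in structs kap loc S ->
    exists F : {ffun 'I_(tot ks) -> 'I_n}, preim_partition F (fib kap S) = q.
  rewrite mem_structs => /and4P[pq _ eq _].
  have [p pD qp] := extend_Dk eK pq eq.
  have [F eF] := gram_realizable uG pD.
  by exists F; apply: preim_partition_sub => //; rewrite eF.
(* The empty partition extends to one in [Dk], realised by a function into ['I_n]; its value at the
   point [K0] shows that [n] is positive. *)
have n0 : (0 < n)%N.
  have [||p pD _] := @extend_Dk _ set0 set0 eK; first by rewrite partition_set0.
    by apply/forall_inP=> C; rewrite in_set0.
  by have [F _] := gram_realizable uG pD; case: n F {uG Ec realize} => // F; case: (F K0).
have Ec' : cumulant_family
    (fun S => haar_Hn n (fun A : 'M[R]_n => \prod_(i in S) Zfun (sigma i) A))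
    (fun B => #|connected_structs kap loc B|%:R).
  move=> S; rewrite (moment_structs R n0 (realize S)).
  rewrite (card_structs (@cycle_cond_restr r ks sigma)) natr_sum.
  by apply: eq_bigr => P _; rewrite natr_prod.
rewrite (cumulant_family_inj Ec Ec' T0); congr (_ %:R).
(* Over the full set of cycles the structures carry evenness, invariance and the prescribed
   restrictions, and connectedness is the condition on the join. *)
congr #|pred_of_set _|; apply/setP=> q; rewrite inE mem_structs fibT !inE gamma_act_fixed.
have [pq|//] := boolP (partition q [set: 'I_(tot ks)]); rewrite /= pjoin_gamma_top //.
have -> : [forall i in [set: 'I_r], restr_cycle ks q i == sigma i] =
    [forall i, restr_cycle ks q i == sigma i].
  by apply: eq_forallb => i; rewrite inE.
have -> : [forall i in [set: 'I_r], forall j in [set: 'I_r], connect (link kap q) i j] =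
    [forall i, forall j, connect (link kap q) i j].
  by apply: eq_forallb => i; rewrite inE; apply: eq_forallb => j; rewrite inE.
by rewrite -/kap andbC andbA; case: [forall i, forall j, _]; rewrite ?andbF ?andbT /= ?andbF // andbC andbA.
Qed.
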